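(* Let $n\ge 2$ be an integer, let $\alpha=(x_1,\dots,x_n):[0,1]\to[0,1]^n$ be the $n$-dimensional Peano curve defined in the context, and let $i\in\{1,\dots,n\}$. Then the coordinate function $x_i$ is self-affine with scale parameter $H=1/n$ to the base $r=3^n$. In particular, $x_i$ is $1/n$-Hölder continuous, i.e. there is a constant $\lambda>0$ such that $|x_i(t)-x_i(t')|\le\lambda|t-t'|^{1/n}$ for all $t,t'\in[0,1]$.
   Context: Fix an integer $n\ge 2$; $\mathbb{N}=\{1,2,3,\dots\}$. Let $D=\{0,1,2\}$ and let $\mathcal{S}_D$ be the set of all sequences $\mathbf{t}=(t_k)_{k\in\mathbb{N}}$ with $t_k\in D$. Let $\xi:D\to D$, $\xi(a)=2-a$, and let $\xi^m$ denote its $m$-fold iterate ($\xi^0=\mathrm{id}$). For $1\le i\le n$, $j\ge 0$ and $\mathbf{t}\in\mathcal{S}_D$ put $$S_{i+jn}(\mathbf{t})=\sum_{k=1}^{i+jn}t_k-\sum_{s=0}^{j}t_{i+sn}\quad(\text{a nonnegative integer}),\qquad x_i(\mathbf{t})=\sum_{j=0}^{\infty}\frac{\xi^{S_{i+jn}(\mathbf{t})}(t_{i+jn})}{3^{j+1}}\in[0,1].$$ Let $\Phi:\mathcal{S}_D\to[0,1]$, $\Phi(\mathbf{t})=\sum_{k\ge1}t_k/3^k$. An element $\mathbf{t}\in\Phi^{-1}(t)$ is called a ternary representation of $t\in[0,1]$. The value $x_i(\mathbf{t})$ is the same for all ternary representations $\mathbf{t}$ of a given $t$, so the function $x_i:[0,1]\to[0,1]$,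 $x_i(t):=x_i(\mathbf{t})$ for any $\mathbf{t}\in\Phi^{-1}(t)$, is well defined. The map $\alpha=(x_1,\dots,x_n)$ is called the $n$-dimensional Peano curve. A function $f:[0,1]\to\mathbb{R}$ is self-affine with scale parameter $H>0$ to the integer base $r\ge 4$ if for any integers $k,s$ with $k\ge 1$ and $0\le s\le r^k-1$ there is $\epsilon(k,s)\in\{-1,1\}$ such that, for every $h$ with $0\le h<r^{-k}$, $$f(sr^{-k}+h)-f(sr^{-k})=\epsilon(k,s)\,r^{-Hk}f(r^kh).$$ *)

(* Defs.v *)
From HB Require Import structures.
From mathcomp Require Export all_boot all_order all_algebra.
From mathcomp Require Export all_classical all_reals all_analysis.

Set Implicit Arguments.
Unset Strict Implicit.
Unset Printing Implicit Defensive.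

Import Order.TTheory GRing.Theory Num.Theory.
Import numFieldNormedType.Exports.

Local Open Scope classical_set_scope.
Local Open Scope ring_scope.

(* The sequence (t_k) is indexed by k >= 1; the value at 0 is never used. *)
Definition digit_seq := nat -> 'I_3.

(* [rev_ord] on ['I_3] is a |-> 2 - a. *)
Definition xi : 'I_3 -> 'I_3 := @rev_ord 3.

(* S_{i+jn}(t).  For 1 <= i the subtracted terms are among the summed ones, so
   the truncated subtraction is exact. *)
Definition peano_S (n i j : nat) (t : digit_seq) : nat :=
  (\sum_(1 <= k < (i + j * n).+1) t k - \sum_(0 <= s < j.+1) t (i + s * n))%N.

Definition ternary_value (R : realType) (t : digit_seq) : R :=
  \big[+%R/(0 : R)]_(1 <= k <oo) ((t k)%:R / 3 ^+ k).

Definition peano_coord_seq (R : realType) (n i : nat) (t : digit_seq) : R :=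
  \big[+%R/(0 : R)]_(0 <= j <oo)
    ((iter (peano_S n i j t) xi (t (i + j * n)%N))%:R / 3 ^+ j.+1).

(* For t in [0, 1] and 1 <= i <= n, the set below is a singleton: all the
   ternary representations of t give the same value. Outside [0, 1] it is
   empty and the value is a dummy. *)
Definition peano_coord (R : realType) (n i : nat) (t : R) : R :=
  get [set peano_coord_seq R n i d | d in [set d | ternary_value R d = t]].

(* Entry i : 'I_n of the row vector is the coordinate x_{i+1}. *)
Definition peano_curve (R : realType) (n : nat) (t : R) : 'rV[R]_n :=
  \row_(i < n) peano_coord n i.+1 t.

(* Self-affinity of a function on [0, 1], represented by f : R -> R; f is only
   evaluated at points of [0, 1[. *)
Definition self_affine (R : realType) (f : R -> R) (H : R) (r : nat) : Prop :=
  [/\ 0 < H, (4 <= r)%N &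
      forall k s : nat, (1 <= k)%N -> (s <= r ^ k - 1)%N ->
      exists2 eps : R, eps = -1 \/ eps = 1 &
      forall h : R, 0 <= h < r%:R ^- k ->
        f (s%:R * r%:R ^- k + h) - f (s%:R * r%:R ^- k) =
        eps * r%:R `^ (- H * k%:R) * f (r%:R ^+ k * h)].

(* Main.v *)
Require Import Defs.
From mathcomp Require Import all_boot all_order all_algebra.
From mathcomp Require Import all_classical all_reals all_analysis.
From mathcomp Require Import ring lra zify.
Import Order.TTheory GRing.Theory Num.Theory.
Import numFieldNormedType.Exports.
Local Open Scope ring_scope.

(* Prefixing a digit sequence by the k n ternary digits of s replaces t by
   (s + t) / 3^(k n), and replaces x_i(t) by A + x_i(t) / 3^k or by
   A + (1 - x_i(t)) / 3^k, according to the parity of the sum of the prefix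
   digits at the positions not congruent to i mod n.  Since x_i does not depend
   on the representation and 222... represents t = 1 as well, this
   self-affinity also holds at the right endpoint of each interval
   [s / 3^(k n), (s + 1) / 3^(k n)].  So x_i oscillates by at most 3^-k on these
   closed intervals, and two points at distance at most 3^-(k n) lie in the same
   interval or in two adjacent ones, which gives the Holder estimate. *)

(** * Ternary expansions of digit sequences indexed from 0 *)

Definition scons (a : 'I_3) (c : nat -> 'I_3) (k : nat) : 'I_3 :=
  if k is k'.+1 then c k' else a.

Lemma scons_eta (c : nat -> 'I_3) : c = scons (c 0%N) (fun k => c k.+1).
Proof. by apply/funext => -[]. Qed.

Section Expansion.
Context {R : realType}.
Implicit Types (c : nat -> 'I_3) (a : 'I_3).

Definition partial_expansion c (m : nat) : R :=
  \sum_(0 <= j < m) (c j)%:R / 3 ^+ j.+1.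

Definition expansion c : R :=
  \big[+%R/(0 : R)]_(0 <= j <oo) ((c j)%:R / 3 ^+ j.+1).

Lemma digit_le2 a : (a%:R : R) <= 2.
Proof. by rewrite ler_nat -ltnS. Qed.

Lemma partial_expansionS c m : partial_expansion c m.+1 =
  ((c 0%N)%:R + partial_expansion (fun k => c k.+1) m) / 3.
Proof.
rewrite /partial_expansion big_nat_recl// expr1 mulrDl; congr (_ + _).
rewrite mulr_suml; apply: eq_bigr => j _.
by rewrite [in LHS]exprSr invfM mulrA.
Qed.

Lemma partial_expansion_le1 c m : partial_expansion c m <= 1.
Proof.
elim: m c => [|m IH] c; first by rewrite /partial_expansion big_geq.
rewrite partial_expansionS.
have := digit_le2 (c 0%N); have := IH (fun k => c k.+1); lra.
Qed.

Lemma cvg_partial_expansion c :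
  (partial_expansion c m @[m --> \oo] --> expansion c)%classic.
Proof.
apply: nondecreasing_is_cvgn.
  apply/nondecreasing_seqP => m.
  by rewrite /partial_expansion big_nat_recr//= lerDl divr_ge0// exprn_ge0.
by exists 1 => _ [m _ <-]; exact: partial_expansion_le1.
Qed.

Lemma expansion_scons a c : expansion (scons a c) = (a%:R + expansion c) / 3.
Proof.
have h : (partial_expansion (scons a c) m.+1 @[m --> \oo] -->
    expansion (scons a c))%classic.
  by have := cvg_partial_expansion (scons a c); rewrite -cvg_shiftS.
rewrite (funext (partial_expansionS (scons a c))) in h.
apply: (cvg_unique _ h) => //.
by apply: cvgMl; apply: cvgD; [exact: cvg_cst|exact: cvg_partial_expansion].
Qed.

Lemma expansion_ge0 c : 0 <= expansion c.
Proof.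
apply: limr_ge; first exact: cvg_partial_expansion.
by apply: nearW => m; apply: sumr_ge0 => j _; rewrite divr_ge0// exprn_ge0.
Qed.

Lemma expansion_le1 c : expansion c <= 1.
Proof.
apply: limr_le; first exact: cvg_partial_expansion.
by apply: nearW => m; exact: partial_expansion_le1.
Qed.

Lemma expansion_xi c : expansion (fun j => xi (c j)) = 1 - expansion c.
Proof.
pose e := expansion (fun j => xi (c j)) + expansion c.
suff : e = 1 by rewrite /e; lra.
(* Since [xi a + a = 2], the two partial sums add up to a geometric sum. *)
have E m : partial_expansion (fun j => xi (c j)) m + partial_expansion c m
    = 1 - 3^-1 ^+ m.
  elim: m c {e} => [|m IH] c.
    by rewrite /partial_expansion !big_geq// expr0 addr0 subrr.
  have := IH (fun k => c k.+1); rewrite !partial_expansionS exprS /=.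
  have : (xi (c 0%N))%:R + (c 0%N)%:R = 2 :> R.
    by rewrite -natrD; congr (_%:R); have := ltn_ord (c 0%N); rewrite /xi /=; lia.
  lra.
have h : (1 - 3^-1 ^+ m @[m --> \oo] --> e)%classic.
  rewrite -(funext E).
  by apply: cvgD; exact: cvg_partial_expansion.
apply: (cvg_unique _ h) => //.
suff : (1 - 3^-1 ^+ m @[m --> \oo] --> (1 - 0 : R))%classic by rewrite subr0.
apply: cvgB; first exact: cvg_cst.
by apply: cvg_expr; rewrite ger0_norm; lra.
Qed.

Lemma expansion_cst0 : expansion (fun=> ord0) = 0.
Proof.
have := expansion_scons ord0 (fun=> ord0); rewrite -(scons_eta (fun=> ord0)) /=.
lra.
Qed.

Lemma expansion_cst2 : expansion (fun=> ord_max) = 1.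
Proof.
have := expansion_scons ord_max (fun=> ord_max).
by rewrite -(scons_eta (fun=> ord_max)) /=; lra.
Qed.

(** Used with [expansion_eq1] to identify the two tails of a double representation. *)
Lemma expansion_eq0 c : expansion c = 0 -> c = (fun=> ord0).
Proof.
move=> h; apply/funext => k; elim: k c h => [|k IH] c.
  rewrite (scons_eta c) expansion_scons /=.
  have := expansion_ge0 (fun k => c k.+1) => ? h.
  apply/val_inj => /=; apply/eqP; rewrite -leqn0 -(ler_nat R).
  lra.
move=> h; apply: (IH (fun k => c k.+1)); move: h.
rewrite (scons_eta c) expansion_scons /=.
have := expansion_ge0 (fun k => c k.+1); have := ler0n R (c 0%N); lra.
Qed.

Lemma xiK : involutive xi. Proof. exact: rev_ordK. Qed.

Lemma expansion_eq1 c : expansion c = 1 -> c = (fun=> ord_max).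
Proof.
move=> h; have : expansion (fun j => xi (c j)) = 0 by rewrite expansion_xi h subrr.
move=> /expansion_eq0 E; apply/funext => k.
by rewrite -[c k]xiK (congr1 (fun d => d k) E); exact/val_inj.
Qed.

Lemma expansion_surj (u : R) : 0 <= u <= 1 -> exists c, expansion c = u.
Proof.
move=> hu.
(* Greedy digits: [dg] reads the leading digit and [T] removes it. The last branch includes [v = 1],
   a fixed point of [T] with digit 2, so [T] preserves the closed interval [0, 1]. *)
pose dg (v : R) : 'I_3 := if v < 3^-1 then inord 0 else
  if v < 2 / 3 then inord 1 else inord 2.
pose T v := 3 * v - (dg v)%:R.
have hT v : 0 <= v <= 1 -> 0 <= T v <= 1.
  rewrite /T /dg; case: ltP => [|?]; last case: ltP => ?; rewrite inordK//; lra.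
pose c u j := dg (iter j T u).
exists (c u).
(* After [m] digits the remainder is [3^-m] times the [m]-th iterate of [T], which stays in [0, 1];
   so it tends to 0. *)
have E m v : v = partial_expansion (c v) m + 3^-1 ^+ m * iter m T v.
  elim: m v => [|m IH] v; first by rewrite /partial_expansion big_geq// expr0 add0r mul1r.
  rewrite partial_expansionS exprS iterSr.
  rewrite (_ : (fun k => c v k.+1) = c (T v)); last first.
    by apply/funext => k; rewrite /c iterSr.
  have -> : c v 0%N = dg v by [].
  have := IH (T v); have : T v = 3 * v - (dg v)%:R by [].
  lra.
have hi m : 0 <= iter m T u <= 1 by elim: m => //= m; exact: hT.
apply/eqP; rewrite eq_sym -subr_eq0 -normr_le0.
have h : (3^-1 ^+ m @[m --> \oo] --> (0 : R))%classic.
  by apply: cvg_expr; rewrite ger0_norm; lra.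
have h2 : (`|u - partial_expansion (c u) m| @[m --> \oo] -->
    `|u - expansion (c u)|)%classic.
  by apply: cvg_norm; apply: cvgB; [exact: cvg_cst|exact: cvg_partial_expansion].
rewrite -(cvg_lim _ h2)// -(cvg_lim _ h)//.
apply: ler_lim; [by apply/cvg_ex; eexists; exact: h2|by apply/cvg_ex; eexists; exact: h|].
apply: nearW => m.
have p0 : (0 : R) <= 3^-1 ^+ m by rewrite exprn_ge0.
have /andP[? ?] := hi m.
rewrite {1}(E m u) addrC addKr ger0_norm ?mulr_ge0// ler_piMr//.
Qed.

(** The word [w] is [s] in base 3, most significant digit first, padded with zeros to length [L]. *)
Lemma expansion_prefix (L s : nat) : (s < 3 ^ L)%N ->
  exists2 w : seq 'I_3, size w = L & forall e : nat -> 'I_3,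
    expansion (foldr scons e w) = (s%:R + expansion e) / 3 ^+ L.
Proof.
elim: L s => [|L IH] s.
  by rewrite expn0 ltnS leqn0 => /eqP ->; exists [::] => // e /=; rewrite expr0 divr1 add0r.
move=> hs; have q3 : (s %/ 3 ^ L < 3)%N by rewrite ltn_divLR ?expn_gt0// -expnS.
have [w sw hw] := IH (s %% 3 ^ L)%N (ltn_pmod _ (expn_gt0 3 L)).
exists (Ordinal q3 :: w); first by rewrite /= sw.
move=> e /=; rewrite expansion_scons hw /= {3}(divn_eq s (3 ^ L)) natrD natrM natrX exprS.
by field; rewrite expf_neq0//; lra.
Qed.

End Expansion.

(** * Coordinates of digit sequences, read digit by digit *)

Lemma iter_xi m a : iter m xi a = if odd m then xi a else a.
Proof. by elim: m => //= m ->; case: odd => //=; rewrite xiK. Qed.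

(* [peano_S], with digits and coordinates indexed from 0. *)
Definition off_sum (n i j : nat) (c : nat -> 'I_3) : nat :=
  (\sum_(0 <= k < (i + j * n).+1) c k - \sum_(0 <= s < j.+1) c (i + s * n))%N.

Lemma off_sumS n i j a (c : nat -> 'I_3) : (0 < n)%N ->
  off_sum n i.+1 j (scons a c) = (a + off_sum n i j c)%N.
Proof.
move=> n0; rewrite /off_sum big_nat_recl//= addnBA//.
(* What remains is that the subtracted digits sum to at most the full sum, so that the truncated
   subtraction is exact. *)
elim: j => [|j IH]; first by rewrite big_nat1 mul0n addn0 big_nat_recr//= leq_addl.
rewrite big_nat_recr//= [leqRHS]big_nat_recr//= leq_add2r (leq_trans IH)//.
rewrite [leqRHS](big_cat_nat (n := (i + j * n).+1))//= ?leq_addr//.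
by rewrite mulSn addnCA -[ltnLHS]add0n -addSn leq_add2r.
Qed.

(** The contributing digit [a] occurs in both sums and cancels; the next contributing digit has
    index [n - 1] in the tail. *)
Lemma off_sum0S n j a (c : nat -> 'I_3) : (0 < n)%N ->
  off_sum n 0 j.+1 (scons a c) = off_sum n n.-1 j c.
Proof.
case: n => // n _; rewrite /off_sum /= add0n mulSn addSn big_nat_recl//=.
rewrite [X in (_ - X)%N]big_nat_recl//= subnDl; congr (_ - _)%N.
Qed.

Section Coord.
Context {R : realType} (n : nat) (n_gt0 : (0 < n)%N).
Implicit Types (b i : nat) (a : 'I_3) (c : nat -> 'I_3) (w : seq 'I_3).

(* [b] is the parity accumulated before reading [c], [i] the distance to the
   next digit that contributes to the coordinate; the paper's x_{i+1} is
   [coord 0 i], with digits indexed from 0. *)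
Definition coord (b i : nat) (c : nat -> 'I_3) : R :=
  expansion (fun j => iter (b + off_sum n i j c) xi (c (i + j * n)%N)).

Lemma coord_sconsS b i a c : coord b i.+1 (scons a c) = coord (b + a) i c.
Proof.
by congr expansion; apply/funext => j; rewrite off_sumS// addnA.
Qed.

Lemma coord_scons0 b a c :
  coord b 0 (scons a c) = ((iter b xi a)%:R + coord b n.-1 c) / 3.
Proof.
rewrite -expansion_scons; congr expansion; apply/funext => -[|j].
  by rewrite /off_sum !big_nat1 subnn addn0.
rewrite off_sum0S//; congr (iter _ xi _).
by rewrite add0n mulSn -(prednK n_gt0) addSn.
Qed.

Lemma coord_parity b i c :
  coord b i c = if odd b then 1 - coord 0 i c else coord 0 i c.
Proof.
rewrite -expansion_xi -(fun_if expansion); congr expansion; apply/funext => j.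
by rewrite iterD iter_xi; case: odd.
Qed.

Lemma coord_bounds b i c : 0 <= coord b i c <= 1.
Proof. by rewrite expansion_ge0 expansion_le1. Qed.

Lemma coord_cst0 b i : coord b i (fun=> ord0) = (odd b)%:R.
Proof.
have E : coord 0 i (fun=> ord0) = 0.
  rewrite -[RHS]expansion_cst0; congr expansion; apply/funext => j.
  by rewrite /off_sum big1_eq sub0n.
by rewrite coord_parity E subr0; case: odd.
Qed.

(** Sums of 2's are even, so only [b] decides whether the digits are flipped. *)
Lemma coord_cst2 b i : coord b i (fun=> ord_max) = (~~ odd b)%:R.
Proof.
have E : coord 0 i (fun=> ord_max) = 1.
  rewrite -[RHS]expansion_cst2; congr expansion; apply/funext => j.
  rewrite /off_sum !sum_nat_const_nat /= -mulnBl iter_xi add0n oddM andbF//.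
by rewrite coord_parity E subrr; case: odd.
Qed.

(* A double representation has the form w a 222... = w (a+1) 000..., and the
   tail of 2's changes no parity. *)
Lemma coord_carry b i c c' : (c 0 < c' 0)%N ->
  expansion c = expansion c' :> R -> coord b i c = coord b i c'.
Proof.
rewrite (scons_eta c) (scons_eta c') !expansion_scons /=.
move: (c 0%N) (c' 0%N) (fun k => c k.+1) (fun k => c' k.+1) => a a' d d' ltaa' e.
have ge1 : (a'%:R : R) >= a%:R + 1 by rewrite natr1 ler_nat.
have d1 := expansion_le1 (R := R) d; have d'0 := expansion_ge0 (R := R) d'.
have ed : expansion d = 1 :> R by lra.
have ed' : expansion d' = 0 :> R by lra.
have ea : a' = a.+1 :> nat.
  by apply/eqP; rewrite -(eqr_nat R) -natr1; apply/eqP; lra.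
rewrite (expansion_eq1 _ ed) (expansion_eq0 _ ed').
(* If the first digit does not contribute, the tails 222... and 000... are read with opposite
   parities and give the same value. If it contributes, its two values differ by 1, which
   compensates the difference of the tails. *)
case: i => [|i]; last by rewrite !coord_sconsS coord_cst0 coord_cst2 ea addnS /= oddD.
rewrite !coord_scons0 coord_cst0 coord_cst2 !iter_xi; case: odd => /=.
  have -> : (xi a)%:R = (xi a')%:R + 1 :> R; last by rewrite addr0.
  by rewrite natr1; congr (_%:R); have := ltn_ord a'; rewrite /xi /=; lia.
by rewrite ea addr0 natr1.
Qed.

(** Equal leading digits are stripped until the first difference, where [coord_carry] applies; [p]
    is some position of difference and bounds the number of strips. *)
Lemma coord_well_defined b i c c' :
  expansion c = expansion c' :> R -> coord b i c = coord b i c'.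
Proof.
have [/funext -> //|/existsNP[p /eqP]] := pselect (forall p, c p = c' p).
have base b1 i1 c1 c2 : c1 0%N != c2 0%N ->
    expansion c1 = expansion c2 :> R -> coord b1 i1 c1 = coord b1 i1 c2.
  rewrite -val_eqE neq_ltn => /orP[lt12|lt21] e; first exact: coord_carry.
  by apply/esym/coord_carry.
elim: p b i c c' => [|p IH] b i c c'; first exact: base.
have [e0 ne|ne0 _] := eqVneq (c 0%N) (c' 0%N); last exact: base.
rewrite (scons_eta c) (scons_eta c') !expansion_scons /= e0.
set d := fun k => c k.+1; set d' := fun k => c' k.+1 => e.
have ed : expansion d = expansion d' :> R by lra.
case: i => [|i]; first by rewrite !coord_scons0 (IH _ _ d d').
by rewrite !coord_sconsS (IH _ _ d d').
Qed.

(** Reading [w] gathers [m] contributing digits into [A] and leaves the state [b'], [i'], none of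
    which depends on the tail [e]. The equation locates the next contributing digit in two ways. *)
Lemma coord_prefix b i w : (i < n)%N -> exists A b' i' m,
  [/\ (i' < n)%N, (i + m * n = size w + i')%N &
      forall e, coord b i (foldr scons e w) = A + coord b' i' e / 3 ^+ m].
Proof.
elim: w b i => [|a w IH] b i ltin.
  exists 0, b, i, 0%N; split=> //=; first by rewrite mul0n addnC.
  by move=> e; rewrite add0r expr0 divr1.
case: i ltin => [_|i ltin].
  have [|A [b' [i' [m [lti' em h]]]]] := IH b n.-1; first by rewrite prednK.
  exists (((iter b xi a)%:R + A) / 3), b', i', m.+1; split=> //=.
    by rewrite mulSn addSn -em add0n -(prednK n_gt0) addSn.
  move=> e; rewrite coord_scons0 h exprS; field.
  by rewrite expf_neq0//; lra.
have [|A [b' [i' [m [lti' em h]]]]] := IH (b + a)%N i; first exact: ltnW.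
exists A, b', i', m; split=> //=; first by rewrite !addSn em.
by move=> e; rewrite coord_sconsS h.
Qed.

End Coord.

(** * The coordinates as functions on [0, 1] and their self-affinity *)

Section PeanoCoord.
Context {R : realType} (n i : nat) (i_lt_n : (i < n)%N).

Let n_gt0 : (0 < n)%N. Proof. exact: leq_ltn_trans i_lt_n. Qed.

Lemma ternary_valueE (d : digit_seq) :
  ternary_value R d = expansion (fun k => d k.+1).
Proof.
have h : (\sum_(1 <= k < m.+1) (d k)%:R / 3 ^+ k @[m --> \oo] -->
    (expansion (fun k => d k.+1) : R))%classic.
  under eq_fun do rewrite big_add1.
  exact: cvg_partial_expansion.
rewrite /ternary_value; apply: cvg_lim => //.
by rewrite -cvg_shiftS.
Qed.

Lemma peano_coord_seqE (d : digit_seq) :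
  peano_coord_seq R n i.+1 d = coord n 0 i (fun k => d k.+1).
Proof.
congr expansion; apply/funext => j.
by rewrite /peano_S /off_sum big_add1 /= addSn.
Qed.

Lemma peano_coordE (c : nat -> 'I_3) :
  peano_coord n i.+1 (expansion c : R) = coord n 0 i c.
Proof.
rewrite /peano_coord.
case: (getPex (P := [set peano_coord_seq R n i.+1 d | d in
    [set d | ternary_value R d = expansion c]]%classic)).
  (* The digit put at index 0 is arbitrary, since only indices from 1 on are read. *)
  exists (coord n 0 i c), (scons ord0 c); last by rewrite peano_coord_seqE.
  by rewrite /= ternary_valueE.
move=> d /= hd <-; rewrite peano_coord_seqE.
by apply: coord_well_defined => //; rewrite -ternary_valueE.
Qed.

Lemma peano_coord_bounds (t : R) : 0 <= t <= 1 -> 0 <= peano_coord n i.+1 t <= 1.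
Proof. by move=> /expansion_surj[c <-]; rewrite peano_coordE coord_bounds. Qed.

Lemma peano_coord_self_affine (k s : nat) : (s < 3 ^ (k * n))%N ->
  exists2 eps : R, eps = -1 \/ eps = 1 & forall u : R, 0 <= u <= 1 ->
    peano_coord n i.+1 ((s%:R + u) / 3 ^+ (k * n)) -
      peano_coord n i.+1 (s%:R / 3 ^+ (k * n)) =
    eps / 3 ^+ k * peano_coord n i.+1 u.
Proof.
move=> /(expansion_prefix (R := R))[w sw hw].
have [A [b [i' [m [lti' em h]]]]] := coord_prefix (R := R) _ n_gt0 0 i w i_lt_n.
(* In [i + m n = k n + i'] both [i] and [i'] are below [n]: a prefix of [k n] digits contains
   exactly [k] contributing ones. *)
have Em : m = k by move: em; rewrite sw; nia.
have Ei : i' = i by move: em; rewrite sw Em; lia.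
move: h; rewrite Em Ei => h.
(* An odd parity after the prefix turns a tail value [x] into [1 - x] and the base point's tail
   value 0 into 1, so the difference is [- x]. *)
exists (if odd b then -1 else 1); first by case: odd; [left|right].
move=> u /expansion_surj[e <-].
have -> : (s%:R : R) / 3 ^+ (k * n) = expansion (foldr scons (fun=> ord0) w).
  by rewrite hw expansion_cst0 addr0.
rewrite -hw !peano_coordE !h coord_cst0 (coord_parity _ b).
by case: odd => /=; lra.
Qed.

(** * Oscillation on the intervals of length 3^-(k n) and the Hölder estimate *)

Lemma peano_coord_dist (k s : nat) (u v : R) : (s < 3 ^ (k * n))%N ->
  0 <= u <= 1 -> 0 <= v <= 1 ->
  `|peano_coord n i.+1 ((s%:R + u) / 3 ^+ (k * n)) -
    peano_coord n i.+1 ((s%:R + v) / 3 ^+ (k * n))| <= 3^-1 ^+ k.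
Proof.
move=> hs hu hv; have [eps heps E] := peano_coord_self_affine _ _ hs.
have := E _ hu; have := E _ hv.
set f := peano_coord _ _; move=> Ev Eu.
have /andP[fu0 fu1] : 0 <= f u <= 1 := peano_coord_bounds _ hu.
have /andP[fv0 fv1] : 0 <= f v <= 1 := peano_coord_bounds _ hv.
have -> : f ((s%:R + u) / 3 ^+ (k * n)) - f ((s%:R + v) / 3 ^+ (k * n)) =
    eps * (f u - f v) * 3^-1 ^+ k by rewrite exprVn; lra.
rewrite normrM [`|_ ^+ k|]ger0_norm ?exprn_ge0// ler_piMl ?exprn_ge0//.
have -> : `|eps * (f u - f v)| = `|f u - f v|.
  by case: heps => ->; rewrite ?mulN1r ?normrN ?mul1r.
by rewrite ler_norml; lra.
Qed.

Lemma peano_coord_close (k : nat) (t t' : R) : 0 <= t -> t <= t' -> t' <= 1 ->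
  t' - t <= 3^-1 ^+ (k * n) ->
  `|peano_coord n i.+1 t - peano_coord n i.+1 t'| <= 2 * 3^-1 ^+ k.
Proof.
move=> t0 tt' t'1 htt'.
(* At [t = 1] the index [s] below would be [3 ^ (k * n)], which is out of range. *)
have [e0|t1] := eqVneq t 1.
  have -> : t = t' by lra.
  by rewrite subrr normr0 mulr_ge0// exprn_ge0.
have {}t1 : t < 1 by lra.
pose q : R := 3 ^+ (k * n).
have q0 : 0 < q by rewrite exprn_gt0.
have /andP[sl su] := truncn_itv (mulr_ge0 (ltW q0) t0).
set s := Num.truncn (q * t) in sl su; rewrite -natr1 in su.
have hs : (s < 3 ^ (k * n))%N.
  by rewrite -(ltr_nat R) natrX -/q (le_lt_trans sl)// gtr_pMr.
have step : q * t' - q * t <= 1.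
  by move: htt'; rewrite exprVn -/q -[q^-1]mul1r ler_pdivlMr// mulrBl ![_ * q]mulrC.
have Eq (x y : R) : q * x = y -> x = y / q.
  by move=> <-; rewrite mulrC mulKf ?gt_eqF.
have qt' : q * t' <= q by rewrite ler_piMr// ltW.
have p0 : (0 : R) <= 3^-1 ^+ k by rewrite exprn_ge0.
have qtt' : q * t <= q * t' by rewrite ler_pM2l.
rewrite (Eq t (s%:R + (q * t - s%:R))); last by rewrite addrC subrK.
have [le1|gt1] := leP (q * t') (s%:R + 1).
  rewrite (Eq t' (s%:R + (q * t' - s%:R))); last by rewrite addrC subrK.
  apply: le_trans (peano_coord_dist _ _ _ _ hs _ _) _; lra.
have hs1 : (s.+1 < 3 ^ (k * n))%N.
  by rewrite -(ltr_nat R) natrX -/q -natr1; lra.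
rewrite (Eq t' (s.+1%:R + (q * t' - s.+1%:R))); last by rewrite addrC subrK.
(* The common endpoint [(s + 1) / q] is the point 1 of the first interval and the point 0 of the
   second. *)
have := @peano_coord_dist k s (q * t - s%:R) 1 hs; rewrite -/q.
have := @peano_coord_dist k s.+1 0 (q * t' - s.+1%:R) hs1; rewrite -/q.
rewrite addr0 natr1.
move=> h2 h1; apply: le_trans (ler_distD (peano_coord n i.+1 (s.+1%:R / q)) _ _) _.
have -> : 2 * 3^-1 ^+ k = 3^-1 ^+ k + 3^-1 ^+ k :> R by lra.
by apply: lerD; [apply: h1|apply: h2]; rewrite -?natr1; lra.
Qed.

Lemma powR_exp3_inv (k : nat) : (3^-1 ^+ (k * n) : R) `^ n%:R^-1 = 3^-1 ^+ k.
Proof.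
rewrite exprM -powR_mulrn ?exprn_ge0// -powRrM mulfV ?powRr1 ?exprn_ge0//.
by rewrite pnatr_eq0 -lt0n.
Qed.

Lemma peano_coord_holder (t t' : R) : 0 <= t <= 1 -> 0 <= t' <= 1 ->
  `|peano_coord n i.+1 t - peano_coord n i.+1 t'| <= 6 * `|t - t'| `^ n%:R^-1.
Proof.
wlog le_tt' : t t' / t <= t'.
  move=> H ht ht'; have [|/ltW] := leP t t'; first by move=> /H; exact.
  by move=> /H; rewrite distrC [`|t' - t|]distrC; exact.
move=> ht ht'; have [->|ne] := eqVneq t t'.
  by rewrite subrr normr0 mulr_ge0// powR_ge0.
rewrite distrC [`|t - t'|]distrC (ger0_norm (_ : 0 <= t' - t)) ?subr_ge0//.
have d0 : 0 < t' - t by rewrite subr_gt0 lt_neqAle ne.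
have ex : exists k, 3^-1 ^+ (k.+1 * n) < t' - t.
  exists (Num.truncn (t' - t)^-1).
  have := truncnS_gt (t' - t)^-1; set m := Num.truncn _ => hm.
  rewrite exprVn invf_plt ?posrE ?exprn_gt0// (lt_le_trans hm)//.
  rewrite -natrX ler_nat (leq_trans (ltnW (ltn_expl m.+1 (isT : 1 < 3)%N)))//.
  by rewrite leq_exp2l// leq_pmulr.
(* Minimality gives [3^-((k+1) n) < t' - t <= 3^-(k n)]; for [k = 0] the upper bound is the length
   of [0, 1]. *)
have [k Pk mink] := ex_minnP ex.
have le_k : t' - t <= 3^-1 ^+ (k * n).
  case: k Pk mink => [_ _|k _ mink]; first by rewrite mul0n expr0; lra.
  by rewrite leNgt; apply/negP => /mink; rewrite ltnn.
rewrite distrC; apply: le_trans (peano_coord_close _ _ _ _ _ _ le_k) _; [lra..|].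
(* The constant is 6 because [2 * 3^-k = 6 * 3^-(k+1)]. *)
have : 3^-1 ^+ k.+1 <= (t' - t) `^ n%:R^-1.
  rewrite -powR_exp3_inv ge0_ler_powR ?invr_ge0 ?nnegrE ?exprn_ge0//; exact: ltW.
by rewrite exprS; lra.
Qed.

End PeanoCoord.

Theorem theorem2 (R : realType) (n : nat) (hn : (2 <= n)%N) (i : 'I_n) :
  self_affine (fun t : R => peano_curve n t ord0 i) n%:R^-1 (3 ^ n)%N /\
  exists2 lambda : R, 0 < lambda &
    forall t t' : R, 0 <= t <= 1 -> 0 <= t' <= 1 ->
      `|peano_curve n t ord0 i - peano_curve n t' ord0 i|
        <= lambda * `|t - t'| `^ n%:R^-1.
Proof.
have n0 : n%:R != 0 :> R by rewrite pnatr_eq0 -lt0n; exact: ltnW.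
split; last first.
  exists 6 => // t t' ht ht'; rewrite !mxE.
  exact: peano_coord_holder.
split=> [||k s k1 hs]; first by rewrite invr_gt0 ltr0n ltnW.
  by rewrite (leq_trans (_ : 4 <= 3 ^ 2)%N)// leq_exp2l.
have {}hs : (s < 3 ^ (k * n))%N.
  by rewrite mulnC expnM (leq_ltn_trans hs)// subn1 prednK// !expn_gt0.
have [eps heps E] := peano_coord_self_affine (R := R) _ _ (ltn_ord i) _ _ hs.
exists eps => // h; rewrite natrX -exprM (mulnC n) => /andP[h0 h1]; rewrite !mxE.
have q0 : (0 : R) < 3 ^+ (k * n) by rewrite exprn_gt0.
have -> : (3 ^+ n : R) `^ (- n%:R^-1 * k%:R) = (3 ^+ k)^-1.
  rewrite -powR_mulrn// -powRrM mulNr mulrN mulrA mulfV// mul1r powRN.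
  by rewrite powR_mulrn.
(* Here [E] is used at [u = 3^(k n) h], which lies in [0, 1] by the bounds on [h]. *)
rewrite -E; last first.
  by rewrite mulr_ge0 ?(ltW q0)//= mulrC -ler_pdivlMr// mul1r ltW.
by rewrite mulrDl [3 ^+ _ * h]mulrC mulfK// gt_eqF.
Qed.
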